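(* Let $A$ be an abelian additive group without $2$-torsion (that is, $2a=0$ implies $a=0$ for all $a\in A$). Then the only GL-structure on the Takasaki kei $T(A)$ is $\operatorname{id}_A$.
   Context: For a set $X$, $S_X$ is the group of permutations of $X$; products of maps denote composition. A rack is a pair $(X,s)$ of a set $X$ and a map $s:X\to S_X$, $x\mapsto s_x$, such that $s_xs_y=s_{s_x(y)}s_x$ for all $x,y\in X$. A rack homomorphism $(X,s)\to(Y,t)$ is a map $\varphi:X\to Y$ with $\varphi s_x=t_{\varphi(x)}\varphi$ for all $x\in X$, and $\operatorname{Aut}R$ is the group of rack automorphisms of $R$. For an abelian group $A$, the Takasaki kei $T(A)$ is the rack with underlying set $A$ and $s_b(a):=2b-a$ for all $a,b\in A$. A GL-structure on a rack $R=(X,s)$ is an automorphism $\mathtt{u}\in\operatorname{Aut}R$ such that $\mathtt{u}s_x=s_x\mathtt{u}$ for all $x\in X$. *)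

(* Defs.v *)
From mathcomp Require Import all_boot all_algebra.

Set Implicit Arguments.
Unset Strict Implicit.
Unset Printing Implicit Defensive.

Import GRing.Theory.
Local Open Scope ring_scope.

(* [rack_op x] is the permutation s_x, so that [rack_op x y] is s_x(y).
   Permutations of a possibly infinite set are bijective functions, and
   equality of maps is extensional. *)
Record rack : Type := Rack {
  rack_sort :> Type;
  rack_op : rack_sort -> rack_sort -> rack_sort;
  rack_op_bij : forall x, bijective (rack_op x);
  rack_op_comp : forall x y,
    rack_op x \o rack_op y =1 rack_op (rack_op x y) \o rack_op x
}.

Definition rack_hom (R S : rack) (f : R -> S) : Prop :=
  forall x : R, f \o rack_op x =1 rack_op (f x) \o f.

Definition rack_aut (R : rack) (f : R -> R) : Prop :=
  rack_hom f /\ bijective f.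

Definition GL_structure (R : rack) (u : R -> R) : Prop :=
  rack_aut u /\ forall x : R, u \o rack_op x =1 rack_op x \o u.

Definition takasaki_op (A : zmodType) (b a : A) : A := b *+ 2 - a.

Lemma takasaki_op_bij (A : zmodType) (b : A) : bijective (takasaki_op b).
Proof. by exists (takasaki_op b) => a; rewrite /takasaki_op subKr. Qed.

Lemma takasaki_op_comp (A : zmodType) (x y : A) :
  takasaki_op x \o takasaki_op y
    =1 takasaki_op (takasaki_op x y) \o takasaki_op x.
Proof.
move=> z; rewrite /= /takasaki_op mulrnBl !opprB.
move: (x *+ 2) (y *+ 2) => a b.
by rewrite mulr2n [RHS]addrC -!addrA addKr addrCA.
Qed.

Definition takasaki (A : zmodType) : rack :=
  Rack (@takasaki_op_bij A) (@takasaki_op_comp A).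

(* Main.v *)
Require Import Defs.
From mathcomp Require Import all_boot all_algebra.
Import GRing.Theory.
Local Open Scope ring_scope.

(** A homomorphism [u] commuting with every [s_x] satisfies [s_x u = u s_x = s_{u(x)} u]. In a
    Takasaki kei the value [s_b(a) = 2b - a] and [a] determine [2b], so [2x = 2u(x)]; without
    2-torsion, doubling is injective. *)

Theorem proposition4p9 (A : zmodType)
    (no_2torsion : forall a : A, a *+ 2 = 0 -> a = 0)
    (u : takasaki A -> takasaki A) :
  GL_structure u <-> u =1 id.
Proof.
split=> [[[u_hom _] u_comm] x | u_id].
  (* Both sides compute [u (s_x x)]: they are [2x - u x] and [2(u x) - u x], and [addIr] cancels the
     common [- u x]. *)
  have := u_hom x x; rewrite u_comm /= /takasaki_op => /addIr eq_2x.
  apply/eqP; rewrite -subr_eq0; apply/eqP/no_2torsion.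
  by rewrite mulrnBl eq_2x subrr.
split; first split.
- by move=> x y; rewrite /= !u_id.
- by exists id => x; rewrite u_id.
- by move=> x y; rewrite /= !u_id.
Qed.
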